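(* Let $B$ be a bipartite hypertournament (that is, a bipartite $k$-hypertournament for some $k\ge 2$) with partite sets $U$ and $W$ and with at least 5 vertices. If a majority bipartite tournament $M(B)$ of $B$ has no transmitters, then $B$ has at least two 4-kings in each of $U$ and $W$.
   Context: Let $n>k\ge 2$ be integers. A $k$-hypertournament on a vertex set $V$ with $|V|=n$ is a pair $(V,A)$, where $A$ is a set of $k$-tuples of distinct vertices (called arcs) such that for every $k$-subset $S$ of $V$, $A$ contains exactly one of the $k!$ tuples whose entries are the elements of $S$. For an arc $x_1x_2\ldots x_k$, $x_i$ precedes $x_j$ if $i<j$. Let $V=U\uplus W$ be a partition of $V$ into two non-empty subsets (partite sets). A bipartite $k$-hypertournament $B$ with partite sets $U$ and $W$ is obtained from a $k$-hypertournament on $V$ by deleting all arcs whose vertices are all contained in $U$ or all contained in $W$. A bipartite $2$-hypertournament is a bipartite tournament. For vertices $u,w$ in different partite sets, $A_B(u,w)$ is the set of arcs of $B$ that contain both $u$ and $w$ and in which $u$ precedes $w$. If $u,w$ are in the same partite set, $A_B(u,w)=\emptyset$. For $u,w$ in different partite sets, $|A_B(u,w)|+|A_B(w,u)|=\binom{n-2}{k-2}$. A path in $B$ of length $q-1$ from $x_1$ to $x_q$ (an $(x_1,x_q)$-path) is an alternating sequence $x_1a_1x_2a_2\dots x_{q-1}a_{q-1}x_q$ of distinct vertices $x_i$ and distinct arcs $a_j$ such that $a_j\in A_B(x_j,x_{j+1})$ for every $j\in\{1,\dots,q-1\}$. (The single vertex $x$ is an $(x,x)$-path of length $0$.) A vertex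 $x$ is a 4-king of $B$ if for every vertex $y$ there is an $(x,y)$-path of length at most $4$ in $B$. A vertex $v$ is a transmitter of $B$ if $A_B(u,v)=\emptyset$ for every vertex $u$ in a different partite set from $v$; in particular, a transmitter of a bipartite tournament is a vertex with no incoming arcs. A majority bipartite tournament $M(B)$ of $B$ is a bipartite tournament with the same partite sets as $B$ such that, for $u,w$ in different partite sets, $uw$ is an arc of $M(B)$ if $|A_B(u,w)|>\frac12\binom{n-2}{k-2}$; if $|A_B(u,w)|=\frac12\binom{n-2}{k-2}$, then exactly one of $uw$, $wu$ is chosen arbitrarily as an arc of $M(B)$. *)

(* Defs.v *)
From mathcomp Require Import all_boot.

Set Implicit Arguments.
Unset Strict Implicit.
Unset Printing Implicit Defensive.

(* The vertex set is a whole finite type V; a (bipartite) k-hypertournament is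
   given by its set of arcs, of type {set k.-tuple V}. *)

Definition hypertournament (V : finType) (k : nat) (A : {set k.-tuple V}) :
    Prop :=
  (forall a : k.-tuple V, a \in A -> uniq a) /\
  (forall S : {set V}, #|S| = k ->
     #|[set a in A | [set x in a] == S]| = 1).

Definition bipartition (V : finType) (U W : {set V}) : Prop :=
  [/\ U :|: W = [set: V], [disjoint U & W], U != set0 & W != set0].

Definition bipartite_hypertournament (V : finType) (k : nat)
    (U W : {set V}) (B : {set k.-tuple V}) : Prop :=
  bipartition U W /\
  exists2 A : {set k.-tuple V}, hypertournament A &
    B = [set a in A | ~~ ([set x in a] \subset U) && ~~ ([set x in a] \subset W)].

Definition opposite (V : finType) (U W : {set V}) (u w : V) : bool :=
  ((u \in U) && (w \in W)) || ((u \in W) && (w \in U)).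

Definition precedes (V : finType) (a : seq V) (u w : V) : bool :=
  [&& u \in a, w \in a & index u a < index w a].

(* A_B(u, w), which is empty when u and w lie in the same partite set. *)
Definition arcs (V : finType) (k : nat) (U W : {set V}) (B : {set k.-tuple V})
    (u w : V) : {set k.-tuple V} :=
  [set a in B | opposite U W u w && precedes a u w].

(* The alternating sequence x a_1 x_2 ... a_(q-1) x_q is encoded by its first
   vertex x and the list [:: (a_1, x_2); ...; (a_(q-1), x_q)], whose size is
   the length q - 1 of the path. *)
Fixpoint alternating (V : finType) (k : nat) (U W : {set V})
    (B : {set k.-tuple V}) (x : V) (s : seq (k.-tuple V * V)) : bool :=
  if s is (a, y) :: s' then (a \in arcs U W B x y) && alternating U W B y s'
  else true.

Definition hpath (V : finType) (k : nat) (U W : {set V})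
    (B : {set k.-tuple V}) (x y : V) (s : seq (k.-tuple V * V)) : bool :=
  [&& alternating U W B x s, uniq (x :: unzip2 s), uniq (unzip1 s)
    & last x (unzip2 s) == y].

Definition king (V : finType) (k : nat) (U W : {set V})
    (B : {set k.-tuple V}) (r : nat) (x : V) : Prop :=
  forall y : V, exists2 s : seq (k.-tuple V * V),
    hpath U W B x y s & size s <= r.

Definition transmitter (V : finType) (k : nat) (U W : {set V})
    (B : {set k.-tuple V}) (v : V) : Prop :=
  forall u : V, opposite U W u v -> arcs U W B u v = set0.

(* A bipartite tournament is a bipartite 2-hypertournament, whose arcs uw are
   the pairs [tuple u; w]; in case of a tie, being a bipartite tournament is
   the only constraint on M. *)
Definition majority (V : finType) (k : nat) (U W : {set V})
    (B : {set k.-tuple V}) (M : {set 2.-tuple V}) : Prop :=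
  bipartite_hypertournament U W M /\
  forall u w : V, opposite U W u w ->
    'C(#|V| - 2, k - 2) < 2 * #|arcs U W B u w| -> [tuple u; w] \in M.

(* Main.v *)
(* Write M for the majority tournament. For any u in U, a vertex x of U with
   the most out-neighbours among the in-neighbours of u reaches every vertex of
   M within 4 steps: it reaches u in 2 steps, and if u' in U dominates some w
   that dominates u, then either x dominates w or x has such an out-neighbour
   not shared by u', through which it reaches u' in 2 steps. As x <> u, doing
   this twice gives two 4-kings of M in U.
   A path of length m <= 4 in M lifts to B as follows. Its i-th step has a set
   S_i of at least C(n-2, k-2) / 2 candidate arcs of B. If an arc belongs to
   three consecutive S_i, it jumps over them, leaving a path of length at most
   2. Otherwise an arc belongs to at most three of the S_i, and to three only
   if m = 4 and it contains all five vertices of the path; double counting then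
   gives Hall's condition for the S_i, hence distinct arcs. *)
Require Import Defs.
From mathcomp Require Import all_boot zify.

Set Implicit Arguments.
Unset Strict Implicit.
Unset Printing Implicit Defensive.

(** * Hall's marriage theorem *)

Section Hall.
Variables (I T : finType).
Implicit Types (S : I -> {set T}) (J : {set I}).

Definition hall S := forall J, #|J| <= #|\bigcup_(i in J) S i|.

Definition remove_at S (i : I) (x : T) (j : I) : {set T} :=
  if j == i then S i :\ x else S j.

(** A family violating the condition after the removal must contain [i], since the other sets are
    unchanged; deleting [i] from it gives [J]. *)
Lemma not_hall_remove S i x :
  hall S -> ~ hall (remove_at S i x) ->
  exists2 J : {set I}, i \notin J & #|(\bigcup_(j in J) S j) :|: (S i :\ x)| <= #|J|.
Proof.
move=> hallS nhall.
have /existsP[J] :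
    [exists J : {set I}, #|\bigcup_(j in J) remove_at S i x j| < #|J|].
  apply: contra_notT nhall; rewrite negb_exists => /forallP h J.
  by rewrite leqNgt; apply: h.
have rest (K : {set I}) : i \notin K ->
    \bigcup_(j in K) remove_at S i x j = \bigcup_(j in K) S j.
  move=> iK; apply: eq_bigr => j jK; rewrite /remove_at.
  by case: eqP => // ji; rewrite ji (negPf iK) in jK.
have [iJ|iJ] := boolP (i \in J); last by rewrite rest // ltnNge hallS.
rewrite (cardsD1 i J) iJ (big_setD1 i iJ) /= {1}/remove_at eqxx rest ?setD11 //.
by rewrite add1n ltnS setUC => le; exists (J :\ i); rewrite ?setD11.
Qed.

(* Rado's argument: if neither [x] nor [y] can be removed from [S i], the two
   tight families of indices violate Hall's condition by submodularity. *)
Lemma hall_remove S i x y :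
  hall S -> x \in S i -> y \in S i -> x != y ->
  hall (remove_at S i x) \/ hall (remove_at S i y).
Proof.
move=> hallS xS yS xy.
have hallP R : reflect (hall R) [forall J : {set I}, #|J| <= #|\bigcup_(i in J) R i|].
  exact: forallP.
have [|nx] := hallP (remove_at S i x); first by left.
have [|ny] := hallP (remove_at S i y); first by right.
have [J iJ leJ] := not_hall_remove hallS nx.
have [K iK leK] := not_hall_remove hallS ny.
set P := _ :|: _ in leJ; set Q := _ :|: _ in leK.
have subU : \bigcup_(j in i |: (J :|: K)) S j \subset P :|: Q.
  apply/bigcupsP => j; rewrite !inE => /or3P[/eqP->|jJ|jK].
  - apply/subsetP => z zS; rewrite !inE zS !andbT.
    by have [->|] := eqVneq z x; rewrite ?xy ?orbT.
  - by rewrite (subset_trans _ (subsetUl _ _)) // subsetU // bigcup_sup.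
  - by rewrite (subset_trans _ (subsetUr _ _)) // subsetU // bigcup_sup.
have subI : \bigcup_(j in J :&: K) S j \subset P :&: Q.
  apply/bigcupsP => j; rewrite inE => /andP[jJ jK].
  by rewrite subsetI !subsetU // bigcup_sup.
(* [P] and [Q] have at most [#|J|] and [#|K|] elements, yet Hall's condition gives their union more
   than [#|J :|: K|] and their intersection at least [#|J :&: K|]. *)
have := leq_trans (hallS _) (subset_leq_card subU).
have := leq_trans (hallS _) (subset_leq_card subI).
rewrite cardsU1 !inE negb_or iJ iK /=.
have := cardsUI P Q; have := cardsUI J K; lia.
Qed.

(** Elements are removed while the condition is kept, until every set is a singleton; the condition
    for pairs of indices then makes these singletons distinct. *)
Theorem hall_transversal S :
  hall S -> exists2 f : I -> T, injective f & forall i, f i \in S i.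
Proof.
have [m] := ubnP (\sum_i #|S i|); elim: m S => // m IHm S.
rewrite ltnS => le_m hallS.
have S_gt0 i : 0 < #|S i| by have := hallS [set i]; rewrite big_set1 cards1.
have [/existsP[i /card_gt1P[x [y [xS yS xy]]]]|] := boolP [exists i, 1 < #|S i|].
  have shrink z : z \in S i -> hall (remove_at S i z) ->
      exists2 f : I -> T, injective f & forall j, f j \in S j.
    move=> zS hz; have [||f injf fS] := IHm (remove_at S i z) => //.
      apply: leq_trans le_m; rewrite (bigD1 i) //= [ltnRHS](bigD1 i) //=.
      rewrite {1}/remove_at eqxx [in ltnRHS](cardsD1 z) zS add1n addSn ltnS leq_add2l.
      by apply: leq_sum => j /negPf ji; rewrite /remove_at ji.
    exists f => // j; have := fS j; rewrite /remove_at.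
    by case: eqP => // ->; rewrite inE => /andP[].
  by have [] := hall_remove hallS xS yS xy; exact: shrink.
rewrite negb_exists => /forallP S_le1.
have S1 i : exists x, S i == [set x].
  have /cards1P[x ->] : #|S i| == 1 by rewrite eqn_leq leqNgt S_le1 S_gt0.
  by exists x.
exists (fun i => xchoose (S1 i)) => [i j eq_ij|i]; last first.
  by rewrite {2}(eqP (xchooseP (S1 i))) set11.
apply/eqP/contraT => ij; have := hallS [set i; j].
rewrite cards2 ij bigcup_setU !big_set1 (eqP (xchooseP (S1 i))).
by rewrite (eqP (xchooseP (S1 j))) eq_ij setUid cards1.
Qed.

End Hall.

Lemma exchange_card (I T : finType) (S : I -> {set T}) (J : {set I}) :
  \sum_(i in J) #|S i| =
  \sum_(a in \bigcup_(i in J) S i) #|[set i in J | a \in S i]|.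
Proof.
rewrite (eq_bigr (fun i => \sum_(a in \bigcup_(j in J) S j) (a \in S i : nat))).
  rewrite exchange_big /=; apply: eq_bigr => a _.
  by rewrite -sum1dep_card big_mkcondr /=; apply: eq_bigr => i _; case: ifP.
move=> i iJ; rewrite -big_mkcondr /= -sum1_card; apply: eq_bigl => a.
have [aS|] := boolP (a \in S i); rewrite ?andbF // andbT.
by apply/esym/bigcupP; exists i.
Qed.

(** * Kings of bipartite tournaments without transmitters *)

Section BipartiteTournament.
Variables (V : finType) (e : rel V) (U : {set V}).
Hypothesis e_bip : forall x y, e x y -> (x \in U) != (y \in U).
Hypothesis e_total : forall x y, (x \in U) != (y \in U) -> e x y || e y x.
Hypothesis e_asym : forall x y, e x y -> ~~ e y x.
Hypothesis e_in : forall y, exists x, e x y.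

(* The king maximises the number of out-neighbours it has among the
   in-neighbours of [u]. *)
Lemma other_4king u : u \in U -> exists2 x, x \in U :\ u &
  forall y, exists p, [/\ path e x p, last x p = y & size p <= 4].
Proof.
move=> uU; pose tr x := [set w | e x w & e w u].
have e_inU w : w \notin U -> exists2 x, x \in U & e x w.
  move=> wU; have [x exw] := e_in w; exists x => //.
  by have := e_bip exw; rewrite (negPf wU); case: (x \in U).
have e_inW x : x \in U -> exists2 w, w \notin U & e w x.
  move=> xU; have [w ewx] := e_in x; exists w => //.
  by have := e_bip ewx; rewrite xU; case: (w \in U).
case: (@arg_maxnP V u (mem U) (fun x => #|tr x|) uU) => x xU x_max.
have {}xU : x \in U := xU.
(* An in-neighbour [w] of [u] and an in-neighbour [y] of [w] show that the maximum is positive. *)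
have [w0 exw0 ew0u] : exists2 w, e x w & e w u.
  have [w wU ewu] := e_inW _ uU; have [y yU eyw] := e_inU _ wU.
  have /card_gt0P[w'] : 0 < #|tr x|.
    by apply: leq_trans (x_max y yU); apply/card_gt0P; exists w; rewrite inE eyw.
  by rewrite inE => /andP[]; exists w'.
have xW w : w \notin U ->
    exists p, [/\ path e x p, last x p = w & size p <= 3].
  move=> wU; have : e u w || e w u by apply: e_total; rewrite uU (negPf wU).
  case/orP => [euw|ewu]; first by exists [:: w0; u; w]; rewrite /= exw0 ew0u euw.
  have [y yU eyw] := e_inU _ wU.
  (* If [tr x] lies in [tr y], maximality makes them equal, and [tr y] contains [w]; otherwise [x]
     reaches [y] through some [w1]. *)
  have [sub|/subsetPn[w1]] := boolP (tr x \subset tr y).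
    have: w \in tr y by rewrite inE eyw.
    have /eqP <- : tr x == tr y by rewrite eqEcard sub; apply: x_max.
    by rewrite inE => /andP[exw _]; exists [:: w]; rewrite /= exw.
  rewrite !inE => /andP[exw1 ew1u]; rewrite ew1u andbT => nyw1.
  have : e w1 y || e y w1.
    by apply: e_total; have := e_bip exw1; rewrite xU yU eq_sym.
  by rewrite (negPf nyw1) orbF => ew1y; exists [:: w1; y; w]; rewrite /= exw1 ew1y eyw.
exists x => [|y].
  rewrite !inE xU andbT; apply: contraL exw0 => /eqP->.
  exact: e_asym.
have [yU|yU] := boolP (y \in U); last first.
  by have [p [? ? ?]] := xW _ yU; exists p; split => //; apply: leqW.
(* A vertex of [U] is one step beyond a vertex outside [U], itself reached in at most 3 steps. *)
have [w wU ewy] := e_inW _ yU; have [p [xp lp sp]] := xW _ wU.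
by exists (rcons p y); rewrite rcons_path last_rcons size_rcons xp lp ewy.
Qed.

End BipartiteTournament.

(** * Numerical bounds *)

Lemma leq_bin_self m j : 0 < j < m -> m <= 'C(m, j).
Proof.
elim: m j => [|m IHm] [|j] //=; rewrite ltnS => le_jm.
rewrite binS; case: j le_jm => [|j] le_jm; first by rewrite bin0 bin1 addn1.
have [lt_jm|le_mj] := ltnP j.+2 m.
  have := IHm j.+2 lt_jm.
  have : 0 < 'C(m, j.+1) by rewrite bin_gt0; lia.
  lia.
have eq_jm : m = j.+2 by lia.
have := IHm j.+1; rewrite eq_jm binn; lia.
Qed.

(** The sum exceeds 2 only when exactly one of four values is false, and that value is an inner
    one. *)
Lemma sum_no_three_consecutive m (b : nat -> bool) : m <= 4 ->
  (forall i, i.+2 < m -> ~~ [&& b i, b i.+1 & b i.+2]) ->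
  \sum_(i < m) (b i : nat) <= 2 + [&& m == 4, b 0, b 3 & b 1 || b 2].
Proof.
move=> m4 nb; have := nb 0; have := nb 1; move: m m4 {nb}.
do 5?case=> //; rewrite ?big_ord_recl ?big_ord0 /bump /=;
  case: (b 0); case: (b 1); case: (b 2); case: (b 3) => //= _ h1 h0;
  solve [by have := h1 isT | by have := h0 isT].
Qed.

(** * Bipartitions and arcs of bipartite hypertournaments *)

Section Bipartition.
Variables (V : finType) (U W : {set V}).
Hypothesis UW : bipartition U W.

Lemma mem_bipartition x : (x \in W) = (x \notin U).
Proof.
case: UW => UWT dUW _; have := in_setT x; rewrite -UWT inE.
by have [xU _|//] := boolP (x \in U); rewrite (disjointFr dUW xU).
Qed.

Lemma oppositeE x y : opposite U W x y = ((x \in U) != (y \in U)).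
Proof. by rewrite /opposite !mem_bipartition; case: (x \in U); case: (y \in U). Qed.

End Bipartition.

Section Hypertournament.
Variables (V : finType) (k : nat) (U W : {set V}) (B : {set k.-tuple V}).
Hypothesis hB : bipartite_hypertournament U W B.
Implicit Types a b : k.-tuple V.

Let UW : bipartition U W. Proof. by case: hB. Qed.

Lemma arc_uniq a : a \in B -> uniq a.
Proof. by case: hB => _ [A [hA _] ->]; rewrite inE => /andP[/hA]. Qed.

Lemma arc_card a : a \in B -> #|[set x in a]| = k.
Proof. by move=> /arc_uniq ua; rewrite cardsE (card_uniqP ua) size_tuple. Qed.

Lemma arc_inj a b : a \in B -> b \in B -> [set x in a] = [set x in b] -> a = b.
Proof.
move=> aB bB eq_ab; have := arc_card aB; move: aB bB.
case: hB => _ [A [_ hA] ->]; rewrite !inE => /andP[aA _] /andP[bA _] /hA/eqP.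
move=> /cards1P[c hc]; have: a \in [set c] by rewrite -hc inE aA eqxx.
have: b \in [set c] by rewrite -hc inE bA eq_ab eqxx.
by rewrite !inE => /eqP-> /eqP->.
Qed.

Lemma arc_exists (S : {set V}) u w :
  #|S| = k -> opposite U W u w -> u \in S -> w \in S ->
  exists2 a, a \in B & [set x in a] = S.
Proof.
move=> cS ouw uS wS; case: hB => _ [A [_ /(_ S cS)/eqP/cards1P[a ha]] ->].
have: a \in [set a] by rewrite inE.
rewrite -ha inE => /andP[aA /eqP aS]; exists a => //.
rewrite inE aA aS /=; have := ouw; rewrite (oppositeE UW) => ne_uw.
apply/andP; split; apply/negP => /subsetP sS; move: (sS _ uS) (sS _ wS) ne_uw.
  by move=> -> ->.
by rewrite !(mem_bipartition UW); case: (u \in U); case: (w \in U).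
Qed.

Lemma arcs_mem a u w : a \in arcs U W B u w ->
  [/\ a \in B, opposite U W u w, u \in a, w \in a & index u a < index w a].
Proof. by rewrite inE => /and3P[? ? /and3P[]]. Qed.

(** Adding [u] and [w] to the subsets of size [k - 2] of the other vertices is injective, and each
    resulting set carries an arc of [B], in which one of [u], [w] precedes the other. *)
Lemma arcs_card u w : 2 <= k -> opposite U W u w ->
  'C(#|V| - 2, k - 2) <= #|arcs U W B u w| + #|arcs U W B w u|.
Proof.
move=> k2 ouw; have uw : u != w.
  by apply: contraTneq ouw => ->; rewrite (oppositeE UW) eqxx.
pose F := [set a in B | (u \in a) && (w \in a)].
have: #|F| <= #|arcs U W B u w| + #|arcs U W B w u|.
  apply: leq_trans (leq_card_setU _ _); apply: subset_leq_card.
  apply/subsetP => a; rewrite !inE /precedes => /and3P[-> ua wa].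
  have -> : opposite U W w u by rewrite (oppositeE UW) eq_sym -(oppositeE UW).
  rewrite ouw ua wa /=; case: ltngtP => // eq_uw.
  by rewrite -(nth_index u ua) eq_uw nth_index ?eqxx in uw.
apply: leq_trans.
have <- : #|~: [set u; w]| = #|V| - 2 by rewrite cardsCs setCK cards2 uw.
rewrite -cards_draws.
have inj : {in [set D : {set V} | D \subset ~: [set u; w] & #|D| == k - 2] &,
    injective (fun D => [set u; w] :|: D)}.
  have disj (D : {set V}) : D \subset ~: [set u; w] -> ([set u; w] :|: D) :\: [set u; w] = D.
    by move=> sD; rewrite setDUl setDv set0U setDE; apply/setIidPl.
  move=> D E; rewrite !inE => /andP[/disj dD _] /andP[/disj dE _] /= eqDE.
  by rewrite -dD -dE eqDE.
rewrite -(card_in_imset inj).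
apply: leq_trans (leq_imset_card (fun a : k.-tuple V => [set x in a]) F).
apply: subset_leq_card; apply/subsetP => _ /imsetP[D + ->].
rewrite inE => /andP[sD /eqP cD].
have cS : #|[set u; w] :|: D| = k.
  rewrite cardsU cards2 uw cD /= disjoint_setI0 ?cards0; first lia.
  by rewrite disjoint_sym disjoints_subset.
have [||a aB aS] := arc_exists cS ouw; rewrite ?inE ?eqxx ?orbT //.
rewrite -aS; apply: imset_f; rewrite inE aB /=.
have : u \in [set x in a] by rewrite aS !inE eqxx.
have : w \in [set x in a] by rewrite aS !inE eqxx orbT.
by rewrite !inE => -> ->.
Qed.

(** * Lifting paths to [B] *)

Lemma alternating_zip z (t : seq (k.-tuple V)) x p : size t = size p ->
  (forall a i, i < size p ->
     nth a t i \in arcs U W B (nth z (x :: p) i) (nth z p i)) ->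
  alternating U W B x (zip t p).
Proof.
elim: p x t => [|y p IHp] x [|a t] //= [st] ht.
by rewrite (ht a 0) //=; apply: IHp => // b i ip; apply: (ht b i.+1).
Qed.

Lemma hpath_hall x p : uniq (x :: p) ->
  hall (fun i : 'I_(size p) => arcs U W B (nth x (x :: p) i) (nth x p i)) ->
  exists2 s, hpath U W B x (last x p) s & size s = size p.
Proof.
move=> up /hall_transversal[f injf fS]; pose t := codom f.
have st : size t = size p by rewrite size_codom card_ord.
exists (zip t p); last by rewrite size_zip st minnn.
rewrite /hpath unzip1_zip ?st // unzip2_zip ?st // up eqxx andbT /=.
rewrite [uniq t](map_inj_uniq injf) enum_uniq andbT.
apply: (@alternating_zip x) => // a i ip; pose i' := Ordinal ip.
rewrite /t codomE (nth_map i') ?size_enum_ord //.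
by rewrite (nth_ord_enum i' i'); exact: fS i'.
Qed.

(** Precedence in [a] is transitive, and three changes of side lead to the opposite side. *)
Lemma arcs_shortcut a x0 x1 x2 x3 :
  a \in arcs U W B x0 x1 -> a \in arcs U W B x1 x2 -> a \in arcs U W B x2 x3 ->
  a \in arcs U W B x0 x3.
Proof.
move=> /arcs_mem[aB o1 a0 _ l1] /arcs_mem[_ o2 _ _ l2] /arcs_mem[_ o3 _ a3 l3].
rewrite inE aB /precedes a0 a3 (ltn_trans (ltn_trans l1 l2) l3) !andbT.
move: o1 o2 o3; rewrite !(oppositeE UW).
by case: (x0 \in U); case: (x1 \in U); case: (x2 \in U).
Qed.

Lemma other_arc a u w : 1 < #|arcs U W B u w| ->
  exists2 b, b \in arcs U W B u w & a != b.
Proof.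
move=> /card_gt1P[b [c [bS cS bc]]].
by have [ab|ab] := eqVneq a b; [exists c => //; rewrite ab | exists b].
Qed.

(** When [k = 2], the first vertex of a step has index 0 in [a], so [a] determines it, and the
    vertices of [x :: p] are distinct. *)
Lemma arcs2_inj x p a (i j : 'I_(size p)) : k = 2 -> uniq (x :: p) ->
  a \in arcs U W B (nth x (x :: p) i) (nth x p i) ->
  a \in arcs U W B (nth x (x :: p) j) (nth x p j) -> i = j.
Proof.
move=> k2 up ai aj.
have first_in_arc u w : a \in arcs U W B u w -> u \in a /\ index u a = 0.
  case/arcs_mem=> _ _ ua wa lt_uw; split=> //; apply/eqP.
  rewrite -leqn0 -ltnS (leq_trans lt_uw) // -ltnS.
  by have := size_tuple a; rewrite {2}k2 => <-; rewrite index_mem.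
have [[ui ei] [uj ej]] := (first_in_arc _ _ ai, first_in_arc _ _ aj).
have /eqP : nth x (x :: p) i = nth x (x :: p) j.
  by rewrite -(nth_index x ui) -(nth_index x uj) ei ej.
rewrite nth_uniq //=; try by rewrite ltnS ltnW // ltn_ord.
by move=> /eqP/val_inj.
Qed.

Lemma lift_path x p : 2 <= k < #|V| -> 5 <= #|V| ->
  uniq (x :: p) -> size p <= 4 ->
  (forall i, i < size p -> 'C(#|V| - 2, k - 2) <=
     2 * #|arcs U W B (nth x (x :: p) i) (nth x p i)|) ->
  exists2 s, hpath U W B x (last x p) s & size s <= 4.
Proof.
move=> /andP[k2 kV] V5 up p4 big.
pose S i := arcs U W B (nth x (x :: p) i) (nth x p i).
have from_hall : hall (fun i : 'I_(size p) => S i) ->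
    exists2 s, hpath U W B x (last x p) s & size s <= 4.
  by move=> /(hpath_hall up)[s ? ss]; exists s; rewrite ?ss.
(* Double counting of the incidences [a \in S i]; letting the inner sum run over all indices instead
   of [J] only enlarges it. *)
have sumS (J : {set 'I_(size p)}) c : (forall i, i < size p -> c <= #|S i|) ->
    c * #|J| <= \sum_(a in \bigcup_(i in J) S i) \sum_(i < size p) (a \in S i : nat).
  move=> cS; apply: (@leq_trans (\sum_(i in J) #|S i|)).
    by rewrite mulnC -sum_nat_const; apply: leq_sum => i _; apply: cS.
  rewrite (exchange_card (fun i : 'I_(size p) => S i)); apply: leq_sum => a _.
  rewrite -sum1dep_card big_mkcond /=; apply: leq_sum => i _.
  by case: (_ \in S i); rewrite ?andbF // andbT; case: (_ \in J).
(* For k = 2 each candidate set is non-empty and the sets are disjoint. *)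
have [k_eq2|k_gt2] : k = 2 \/ 2 < k by lia.
  apply: from_hall => J; rewrite -[#|J|]mul1n.
  apply: leq_trans (sumS J 1 _) _ => [i ip|].
    have k20 : k - 2 = 0 by rewrite k_eq2.
    by have := big i ip; rewrite k20 bin0 -/(S i); lia.
  rewrite -sum1_card; apply: leq_sum => a _.
  have [/existsP[i aSi]|] := boolP [exists i : 'I_(size p), a \in S i].
    rewrite (bigD1 i) //= aSi big1 // => j ji.
    by apply/eqP; rewrite eqb0; apply: contra ji => aSj; apply/eqP/(arcs2_inj _ up aSj).
  by rewrite negb_exists => /forallP h; rewrite big1 // => i _; rewrite (negPf (h i)).
(* Here [0 < k - 2 < #|V| - 2], so the binomial is at least 3, and each [S i], having at least half
   that size, contains two arcs. *)
have C_ge : #|V| - 2 <= 'C(#|V| - 2, k - 2) by apply: leq_bin_self; lia.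
have S_gt1 i : i < size p -> 1 < #|S i| by move=> /big; rewrite -/(S i); lia.
have [/existsP[a /existsP[i /and4P[i2 ai0 ai1 ai2]]]|no_sc] :=
  boolP [exists a : k.-tuple V, [exists i : 'I_(size p),
    [&& i.+2 < size p, a \in S i, a \in S i.+1 & a \in S i.+2]]].
  have a_sc := arcs_shortcut ai0 ai1 ai2.
  move: i i2 {ai0 ai1 ai2 big from_hall sumS} a_sc up S_gt1; rewrite {}/S.
  case: p p4 => [|x1 [|x2 [|x3 [|x4 [|? ?]]]]] // p4 [[|[|[|i]]] ip] //= _ a_sc up S_gt1.
  (* The shortcut replaces a whole path of length 3; for length 4 one step remains, at the end or at
     the start, and takes an arc other than [a]. *)
  - move: up; rewrite !inE !negb_or => up; exists [:: (a, x3)] => //.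
    by move: up; rewrite /hpath /= a_sc inE eqxx; do !case: (_ == _) => //=.
  - have [b bS ab] := other_arc a (S_gt1 3 isT).
    move: up; rewrite !inE !negb_or => up; exists [:: (a, x3); (b, x4)] => //.
    move: up; rewrite /hpath /= a_sc bS !inE ab eqxx.
    by do !case: (_ == _) => //=.
  - have [b bS ab] := other_arc a (S_gt1 0 isT).
    move: up; rewrite !inE !negb_or => up; exists [:: (b, x1); (a, x4)] => //.
    move: up; rewrite /hpath /= a_sc bS !inE (eq_sym b) ab eqxx.
    by do !case: (_ == _) => //=.
pose spans a := [&& size p == 4, a \in S 0, a \in S 3 & (a \in S 1) || (a \in S 2)].
have sum_a a : \sum_(i < size p) (a \in S i : nat) <= 2 + spans a.
  apply: (sum_no_three_consecutive (b := fun i => a \in S i)) => // i i2.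
  move: no_sc; rewrite negb_exists => /forallP/(_ a); rewrite negb_exists.
  by move=> /forallP/(_ (Ordinal (ltn_trans (ltnW (ltnSn i.+1)) i2))); rewrite i2.
(* For n >= 7 each candidate set has at least 3 elements. *)
apply: from_hall => J; have [V7|V6] := leqP 7 #|V|.
  rewrite -(@leq_pmul2l 3) //; apply: leq_trans (sumS J 3 _) _ => [i /big|].
    by rewrite -/(S i); lia.
  rewrite mulnC -sum_nat_const; apply: leq_sum => a _.
  by apply: leq_trans (sum_a a) _; case: (spans a).
(* For n <= 6 we have k <= 5, so at most one arc contains the five vertices of
   the path, and only that arc lies in three candidate sets. *)
suff : 2 * #|J| <= 2 * #|\bigcup_(i in J) S i| + 1 by lia.
apply: leq_trans (sumS J 2 S_gt1) _.
apply: (@leq_trans (\sum_(a in \bigcup_(i in J) S i) (2 + spans a))).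
  by apply: leq_sum.
rewrite big_split /= sum_nat_const mulnC leq_add2l.
rewrite -big_mkcondr sum1_card /=.
apply/card_le1_eqP => a b /andP[_ ha] /andP[_ hb].
(* The outer steps put four path vertices in [c] and either inner step puts the middle one; as
   [k <= 5], [c] has no other vertex. *)
have full c : spans c -> (c \in B) /\ [set y in c] = [set y in x :: p].
  move=> /and4P[/eqP sp c0 c3 c12].
  have cB : c \in B by case/arcs_mem: c0.
  split => //; apply/eqP; rewrite eq_sym eqEcard arc_card // cardsE (card_uniqP up) /=.
  rewrite sp (leq_trans (_ : k <= 5)) ?andbT //; last lia.
  move: c0 c3 c12 sp; rewrite /S; clear -p4.
  case: p p4 => [|x1 [|x2 [|x3 [|x4 [|? ?]]]]] //= _.
  move=> /arcs_mem[_ _ i0 i1 _] /arcs_mem[_ _ i3 i4 _] i12 _.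
  have i2 : x2 \in c by case/orP: i12 => /arcs_mem[].
  by apply/subsetP => y; rewrite !inE => /or4P[|||/orP[]] /eqP->.
have [aB aE] := full _ ha; have [bB bE] := full _ hb.
by apply: arc_inj; rewrite // aE bE.
Qed.

End Hypertournament.

(** * Bipartite 2-hypertournaments as relations *)

Lemma tuple2_cases (T : Type) (a : 2.-tuple T) : exists x y, a = [tuple x; y].
Proof.
case/tupleP: a => x a; case/tupleP: a => y a; exists x, y.
by apply: val_inj; rewrite /= (tuple0 a).
Qed.

Section MajorityTournament.
Variables (V : finType) (U W : {set V}) (M : {set 2.-tuple V}).
Hypothesis hM : bipartite_hypertournament U W M.

Let UW : bipartition U W. Proof. by case: hM. Qed.

Definition dominates : rel V := fun u w => [tuple u; w] \in M.

Lemma dominates_opposite u w : dominates u w -> opposite U W u w.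
Proof.
rewrite /dominates (oppositeE UW); case: hM => _ [A _ ->]; rewrite inE => /andP[_].
apply: contraTN => /eqP eq_uw; rewrite negb_and !negbK.
have [uU|uU] := boolP (u \in U); apply/orP; [left | right];
  apply/subsetP => z; rewrite !inE ?(mem_bipartition UW) => /orP[] /eqP -> //.
  by rewrite -eq_uw.
by rewrite -eq_uw.
Qed.

Lemma dominates_total u w : opposite U W u w -> dominates u w || dominates w u.
Proof.
move=> ouw; have uw : u != w.
  by apply: contraTneq ouw => ->; rewrite (oppositeE UW) eqxx.
have [|||a aM aE] := arc_exists hM (S := [set u; w]) _ ouw;
  rewrite ?cards2 ?uw ?inE ?eqxx ?orbT //.
have := arc_uniq hM aM; have [a0 [a1 a01E]] := tuple2_cases a.
rewrite {}a01E /dominates /= inE andbT in aM aE * => a01.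
have : (a0 == u) || (a0 == w) by move/setP/(_ a0): aE; rewrite !inE eqxx /= => <-.
have : (a1 == u) || (a1 == w) by move/setP/(_ a1): aE; rewrite !inE eqxx orbT => <-.
move=> /orP[] /eqP e1 /orP[] /eqP e0; move: a01 aM; rewrite e0 e1 ?eqxx // => _ -> //.
by rewrite orbT.
Qed.

Lemma dominates_asym u w : dominates u w -> ~~ dominates w u.
Proof.
move=> uw; apply/negP => wu; have := dominates_opposite uw.
have /(congr1 val)[->] : [tuple u; w] = [tuple w; u].
  by apply: (arc_inj hM) => //; apply/setP => z; rewrite !inE orbC.
by rewrite (oppositeE UW) eqxx.
Qed.

Lemma dominates_in w : ~ transmitter U W M w -> exists u, dominates u w.
Proof.
move=> nt; apply/existsP; apply: contra_notT nt; rewrite negb_exists => /forallP h.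
move=> u ouw; apply/setP => a; rewrite [RHS]inE; apply/negP => /arcs_mem[aM _ ua wa +].
have [x [y aE]] := tuple2_cases a; rewrite {}aE /= !inE in aM ua wa * => lt_uw.
move: lt_uw ua wa (h u); rewrite /dominates !(eq_sym _ x) !(eq_sym _ y).
do 2!case: (eqVneq x _) => [<-|_] //=.
  by move=> _ _ /eqP <-; rewrite aM.
by case: (y == u); case: (y == w).
Qed.

End MajorityTournament.

(** As [w] does not dominate [u], at most half of the binomial counts arcs from [w] to [u];
    [arcs_card] leaves at least half for the other direction, ties included. *)
Lemma dominates_majority (V : finType) (k : nat) (U W : {set V})
    (B : {set k.-tuple V}) (M : {set 2.-tuple V}) u w :
  2 <= k -> bipartite_hypertournament U W B -> majority U W B M ->
  dominates M u w -> 'C(#|V| - 2, k - 2) <= 2 * #|arcs U W B u w|.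
Proof.
move=> k2 hB [hM maj] uw; have UW : bipartition U W by case: hB.
have ouw := dominates_opposite hM uw.
have owu : opposite U W w u by rewrite (oppositeE UW) eq_sym -(oppositeE UW).
have := contra (maj _ _ owu) (dominates_asym hM uw).
by have := arcs_card hB k2 ouw; lia.
Qed.

Theorem theorem13 (V : finType) (k : nat) (U W : {set V})
    (B : {set k.-tuple V}) (M : {set 2.-tuple V}) :
  2 <= k -> k < #|V| -> 5 <= #|V| ->
  bipartite_hypertournament U W B ->
  majority U W B M ->
  (forall v : V, ~ transmitter U W M v) ->
  (exists x y : V, [/\ x \in U, y \in U, x != y,
                      king U W B 4 x & king U W B 4 y]) /\
  (exists x y : V, [/\ x \in W, y \in W, x != y,
                      king U W B 4 x & king U W B 4 y]).
Proof.
move=> k2 kV V5 hB majM no_transmitter; have [hM _] := majM.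
have UW : bipartition U W by case: hB.
have sideW x y : ((x \in W) != (y \in W)) = ((x \in U) != (y \in U)).
  by rewrite !(mem_bipartition UW); case: (x \in U); case: (y \in U).
have king_of x : (forall y, exists p,
    [/\ path (dominates M) x p, last x p = y & size p <= 4]) -> king U W B 4 x.
  move=> reach y; have [p [xp <- sp]] := reach y.
  (* Lifting needs distinct vertices, so repetitions are first cut out of the walk, which does not
     lengthen it. *)
  case/shortenP: xp => q xq uq /uniq_leq_size sq.
  apply: (lift_path hB) => //; first by rewrite k2.
    by apply: leq_trans sp; apply: sq; case/andP: uq.
  by move=> i iq; apply: (dominates_majority k2 hB majM); apply: (pathP x xq).
have two_kings (X : {set V}) : X != set0 ->
    (forall x y, opposite U W x y = ((x \in X) != (y \in X))) ->
    exists x y, [/\ x \in X, y \in X, x != y, king U W B 4 x & king U W B 4 y].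
  move=> /set0Pn[u uX] oppX.
  have other v : v \in X -> exists2 x, x \in X :\ v & king U W B 4 x.
    move=> vX; have [| | | |x xX reach] := other_4king (e := dominates M) _ _ _ _ vX.
    - by move=> x y /(dominates_opposite hM); rewrite oppX.
    - by move=> x y; rewrite -oppX; apply: dominates_total.
    - exact: dominates_asym hM.
    - by move=> y; apply: (dominates_in (no_transmitter y)).
    - by exists x => //; apply: king_of.
  have [x] := other _ uX; rewrite !inE => /andP[_ xX] kx.
  have [y] := other _ xX; rewrite !inE => /andP[yx yX] ky.
  by exists x, y; rewrite eq_sym.
have [_ _ U0 W0] := UW.
by split; apply: two_kings => // x y; rewrite ?sideW (oppositeE UW).
Qed.
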